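(* Let $M$ be a complete lattice. The following are equivalent: (i) $\mathrm{CEnd}_{\mathbf{B}}(M)$ is simple; (ii) $\mathrm{CEnd}_{\mathbf{B}}(M)$ is ideal-simple; (iii) $M$ is a finite distributive lattice.
   Context: A semiring $(R,+,\cdot,0,1)$ consists of a commutative monoid $(R,+,0)$ and a monoid $(R,\cdot,1)$ such that multiplication distributes over addition on both sides and $0r=0=r0$ for all $r\in R$. An ideal is an additive submonoid closed under left and right multiplication by elements of $R$. A semiring $R$ is ideal-simple if $0$ and $R$ are its only ideals; congruence-simple if the diagonal and the universal relation $R^2$ are its only congruences; simple if it is both ideal-simple and congruence-simple. A complete lattice $M$ is regarded as a complete semimodule over the Boolean semifield $\mathbf{B}=\{0,1\}$ ($1+1=1$) with $x+y=x\vee y$, $0$ the least element, and $\sum_{i\in\Omega}m_i=\bigvee_{i\in\Omega}m_i$. $\mathrm{CEnd}_{\mathbf{B}}(M)$ is the semiring of all complete endomorphisms of $M$, i.e. all maps $M\to M$ preserving arbitrary joins (including the empty join $0$), with pointwise addition (join) and composition as multiplication. *)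

(* Defs.v *)
From HB Require Import structures.
From mathcomp Require Import all_boot all_order all_algebra.
From mathcomp Require Import all_classical.

Set Implicit Arguments.
Unset Strict Implicit.
Unset Printing Implicit Defensive.

Import Order.TTheory GRing.Theory.
Local Open Scope classical_set_scope.
Local Open Scope ring_scope.

(* [pzSemiRingType] allows 1 = 0, so the one-element semiring is included. *)
Section Semirings.
Variable R : pzSemiRingType.

Record is_ideal (I : set R) : Prop := IsIdeal {
  ideal0 : I 0;
  idealD : forall x y, I x -> I y -> I (x + y);
  idealMl : forall r x, I x -> I (r * x);
  idealMr : forall r x, I x -> I (x * r) }.

Record is_congruence (E : R -> R -> Prop) : Prop := IsCongruence {
  congr_refl : forall x, E x x;
  congr_sym : forall x y, E x y -> E y x;
  congr_trans : forall x y z, E x y -> E y z -> E x z;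
  congrD : forall x y x' y', E x y -> E x' y' -> E (x + x') (y + y');
  congrM : forall x y x' y', E x y -> E x' y' -> E (x * x') (y * y') }.

Definition ideal_simple : Prop :=
  forall I : set R, is_ideal I -> I = [set 0] \/ I = [set: R].

Definition congruence_simple : Prop :=
  forall E : R -> R -> Prop, is_congruence E ->
    (forall x y, E x y <-> x = y) \/ (forall x y, E x y).

Definition simple_semiring : Prop := ideal_simple /\ congruence_simple.

End Semirings.

Section CEnd.
Context {d : Order.disp_t}.

(* [supremums A] is the set of least upper bounds of [A]. *)
Definition complete_lattice (M : tbLatticeType d) : Prop :=
  forall A : set M, supremums A !=set0.

Definition distributive_lattice (M : tbLatticeType d) : Prop :=
  left_distributive (@Order.meet d M) (@Order.join d M).

Variable M : tbLatticeType d.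

(* The sets [A] are arbitrary; in particular [A = set0] gives [f \bot = \bot]. *)
Definition preserves_joins (f : M -> M) : Prop :=
  forall (A : set M) (s : M), supremums A s -> supremums (f @` A) (f s).

Record cend : Type := CEnd {
  cend_fun :> M -> M;
  cend_joins : preserves_joins cend_fun }.

HB.instance Definition _ := gen_eqMixin cend.
HB.instance Definition _ := gen_choiceMixin cend.

Lemma cendP (f g : cend) : f =1 g -> f = g.
Proof.
case: f g => [f hf] [g hg] /= /funext fg.
by case: _ / fg hg => hg; congr CEnd; exact: Prop_irrelevance.
Qed.

Lemma supremums_set0 : supremums set0 (\bot%O : M).
Proof. by split => // y _; exact: le0x. Qed.

Lemma supremums_set2 (x y : M) : supremums [set x; y] (Order.join x y).
Proof.
split; first by move=> z [|] ->; rewrite ?leUl ?leUr.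
by move=> z zub; rewrite leUx; apply/andP; split; apply: zub; [left|right].
Qed.

Lemma cend_bot (f : cend) : f \bot%O = \bot%O.
Proof.
have := cend_joins f supremums_set0; rewrite image_set0 => fs.
exact: is_subset1_supremums fs supremums_set0.
Qed.

Lemma cend_join (f : cend) (x y : M) :
  f (Order.join x y) = Order.join (f x) (f y).
Proof.
have := cend_joins f (supremums_set2 x y).
rewrite image_setU !image_set1 => fs.
exact: is_subset1_supremums fs (supremums_set2 _ _).
Qed.

Lemma bot_preserves_joins : preserves_joins (fun=> \bot%O).
Proof.
move=> A s _; split; first by move=> _ [x _ <-].
by move=> y _; exact: le0x.
Qed.

Lemma join_preserves_joins (f g : cend) :
  preserves_joins (fun x => Order.join (f x) (g x)).
Proof.
move=> A s As; have [fub flb] := cend_joins f As.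
have [gub glb] := cend_joins g As; split.
  by move=> _ [x Ax <-]; apply: leU2; [apply: fub | apply: gub]; exists x.
move=> y yub; rewrite leUx; apply/andP; split.
  apply: flb => _ [x Ax <-]; apply: le_trans (yub _ _); last by exists x.
  exact: leUl.
apply: glb => _ [x Ax <-]; apply: le_trans (yub _ _); last by exists x.
exact: leUr.
Qed.

Lemma id_preserves_joins : preserves_joins id.
Proof. by move=> A s; rewrite image_id. Qed.

Lemma comp_preserves_joins (f g : cend) : preserves_joins (f \o g).
Proof.
by move=> A s As; rewrite -image_comp; do 2! apply: cend_joins.
Qed.

Definition cend_zero : cend := CEnd bot_preserves_joins.
Definition cend_add (f g : cend) : cend := CEnd (join_preserves_joins f g).
Definition cend_one : cend := CEnd id_preserves_joins.
Definition cend_mul (f g : cend) : cend := CEnd (comp_preserves_joins f g).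

Lemma cend_addA : associative cend_add.
Proof. by move=> f g h; apply: cendP => x; exact: joinA. Qed.

Lemma cend_addC : commutative cend_add.
Proof. by move=> f g; apply: cendP => x; exact: joinC. Qed.

Lemma cend_add0 : left_id cend_zero cend_add.
Proof. by move=> f; apply: cendP => x; exact: join0x. Qed.

Lemma cend_mulA : associative cend_mul.
Proof. by move=> f g h; apply: cendP. Qed.

Lemma cend_mul1l : left_id cend_one cend_mul.
Proof. by move=> f; apply: cendP. Qed.

Lemma cend_mul1r : right_id cend_one cend_mul.
Proof. by move=> f; apply: cendP. Qed.

Lemma cend_mulDl : left_distributive cend_mul cend_add.
Proof. by move=> f g h; apply: cendP. Qed.

Lemma cend_mulDr : right_distributive cend_mul cend_add.
Proof. by move=> f g h; apply: cendP => x; exact: cend_join. Qed.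

Lemma cend_mul0l : left_zero cend_zero cend_mul.
Proof. by move=> f; apply: cendP. Qed.

Lemma cend_mul0r : right_zero cend_zero cend_mul.
Proof. by move=> f; apply: cendP => x; exact: cend_bot. Qed.

HB.instance Definition _ := GRing.isPzSemiRing.Build cend
  cend_addA cend_addC cend_add0 cend_mulA cend_mul1l cend_mul1r
  cend_mulDl cend_mulDr cend_mul0l cend_mul0r.

End CEnd.

(* Main.v *)
Require Import Defs.
From mathcomp Require Import all_boot all_order all_algebra.
From mathcomp Require Import all_classical.

(** The step maps [x |-> if x <= a then 0 else b] absorb composition on both
    sides, so their finite joins form an ideal, and every ideal (or congruence
    class of 0) that is nontrivial contains all of them. Hence everything
    hinges on whether the identity is a finite join of step maps. If it is,
    then [x] is determined by the finitely many truth values [x <= a_i], and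
    each [b_i] with [~ w <= a_i] lies below [w], which forces distributivity.
    Conversely, in a finite distributive lattice each [x] is a join of prime
    elements [p], and for [p] prime and [a] the join of all [z] not above [p],
    the step map at [a] with value [p] lies below the identity. *)

Local Open Scope classical_set_scope.

Section StepMaps.
Import Order.TTheory GRing.Theory.
Local Open Scope order_scope.
Set Implicit Arguments.
Unset Strict Implicit.
Context {d : Order.disp_t} {M : tbLatticeType d}.
Implicit Types (a b c x y z p : M) (f g : cend M) (s : seq M).

Lemma step_preserves_joins a b :
  preserves_joins (fun x : M => if x <= a then \bot else b).
Proof.
move=> A s [sub slb]; split=> [_ [x Ax <-]|y yub].
  case: ifPn => [_|xa]; first exact: le0x.
  by rewrite ifN //; apply: contra xa; apply: le_trans; exact: sub.
case: ifPn => [_|sa]; first exact: le0x.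
have [x Ax xa] : exists2 x, A x & ~~ (x <= a).
  apply: contrapT => nA; move/negP: sa; apply; apply: slb => x Ax.
  by apply: contrapT => /negP xa; apply: nA; exists x.
by apply: yub; exists x => //; rewrite (negbTE xa).
Qed.

Definition step a b : cend M := CEnd (step_preserves_joins a b).

Lemma mul_step f a b : (f * step a b)%R = step a (f b).
Proof. by apply: cendP => x /=; case: ifP => // _; exact: cend_bot. Qed.

(** The new threshold is the right adjoint of [f] at [a]: the largest [x] with [f x <= a], which
    exists because [f] preserves joins. *)
Lemma step_mul (hM : complete_lattice M) f a b :
  exists a', (step a b * f)%R = step a' b.
Proof.
have [t tsup] := hM [set x | f x <= a].
have [fub flb] := cend_joins f tsup; have [tub tlb] := tsup.
exists t; apply: cendP => x /=; suff -> : (f x <= a) = (x <= t) by [].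
apply/idP/idP => [|xt]; first exact: tub.
have fxt : f x <= f t by rewrite leEjoin -cend_join (join_r xt).
by apply: le_trans fxt _; apply: flb => _ [y ya <-].
Qed.

(** Sandwiching [f] between step maps tests one inequality; this is how a nonzero map, or a pair of
    distinct related maps, yields every step map. *)
Lemma step_conj f a c x y :
  (step y c * (f * step x a))%R = if f a <= y then 0%R else step x c.
Proof.
by rewrite !mul_step /=; case: ifP => // _; apply: cendP => z /=; case: ifP.
Qed.

Definition step_sum (r : seq (M * M)) : cend M :=
  (\sum_(ab <- r) step ab.1 ab.2)%R.

Lemma step_sumE r x :
  step_sum r x = \join_(ab <- r | ~~ (x <= ab.1)) ab.2.
Proof.
rewrite /step_sum; elim: r => [|ab r IHr]; first by rewrite !big_nil.
rewrite !big_cons /= IHr; case: ifP => _ //=; exact: join0x.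
Qed.

Lemma step_sum_ideal (hM : complete_lattice M) : is_ideal (range step_sum).
Proof.
split.
- by exists [::] => //; rewrite /step_sum big_nil.
- move=> _ _ [r _ <-] [r' _ <-]; exists (r ++ r') => //.
  exact: big_cat.
- move=> f _ [r _ <-]; exists [seq (ab.1, f ab.2) | ab <- r] => //.
  rewrite /step_sum big_map big_distrr /=.
  by apply: eq_bigr => ab _; rewrite mul_step.
- move=> f _ [r _ <-].
  exists [seq (projT1 (cid (step_mul hM f ab.1 ab.2)), ab.2) | ab <- r] => //.
  rewrite /step_sum big_map big_distrl /=.
  by apply: eq_bigr => ab _; case: cid.
Qed.

Lemma ideal_simple_one_step_sum (hM : complete_lattice M) :
  ideal_simple (cend M) -> exists r, step_sum r = 1%R.
Proof.
move=> /(_ _ (step_sum_ideal hM)) [] I_eq; last first.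
  by have [r _ r1] : range step_sum 1%R; [rewrite I_eq | exists r].
(* If the ideal is zero, then [M] is a single point, and the empty sum is already the identity. *)
have step0 : step \bot \top = 0%R.
  suff : range step_sum (step \bot \top) by rewrite I_eq.
  by exists [:: (\bot, \top)]; rewrite // /step_sum big_seq1.
have top_bot : \top = \bot :> M.
  have /(congr1 (fun f : cend M => f \top)) /= := step0.
  by case: ifP => //; rewrite lex0 => /eqP.
exists [::]; apply: cendP => x; rewrite /step_sum big_nil /=.
by apply/le_anti; rewrite le0x -top_bot lex1.
Qed.

Section OneStepSum.
Variable r : seq (M * M).
Hypothesis r1 : step_sum r = 1%R.

Let idE x : x = \join_(ab <- r | ~~ (x <= ab.1)) ab.2.
Proof. by rewrite -step_sumE r1. Qed.

Lemma one_step_sum_finite : finite_set [set: M].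
Proof.
pose F (t : (size r).-tuple bool) : M := \join_(ab <- mask t r) ab.2.
apply: (@sub_finite_set _ _ (range F)); last exact: finite_image.
move=> x _; exists [tuple of [seq ~~ (x <= ab.1) | ab <- in_tuple r]] => //.
by rewrite /F /= -filter_mask big_filter -idE.
Qed.

Lemma one_step_sum_distributive : distributive_lattice M.
Proof.
have le_val ab x : ab \in r -> ~~ (x <= ab.1) -> ab.2 <= x.
  by move=> abr xa; rewrite [leRHS]idE; exact: joins_sup_seq.
move=> x y z; apply/le_anti/andP; split; last first.
  by rewrite leUx !leI2 ?leUl ?leUr.
(* If the meet is not below [ab.1], then neither is [z], nor at least one of [x] and [y]; so [ab.2]
   lies below [z] and below that one. *)
rewrite [leLHS]idE; apply/joinsP_seq => ab abr wa.
have az : ab.2 <= z.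
  by apply: le_val => //; apply: contra wa; apply: le_trans; exact: leIr.
have : ~~ (x `|` y <= ab.1).
  by apply: contra wa; apply: le_trans; exact: leIl.
rewrite leUx negb_and.
by case/orP=> /(le_val _ _ abr) ale; apply: lexU2; rewrite !lexI ale az ?orbT.
Qed.

End OneStepSum.

Section FiniteDistributive.
Hypothesis finM : finite_set [set: M].
Hypothesis distrM : distributive_lattice M.

Lemma minimal_exists (P : M -> Prop) :
  (exists x, P x) -> exists2 p, P p & forall q, q < p -> ~ P q.
Proof.
have [s sE] := (finite_seqP _).1 finM.
have mem_s z : z \in s by have : [set: M] z by []; rewrite sE.
(* Descent on the number of entries of [s] below [x]. *)
pose k x := count (<= x) s.
move=> [x Px]; have [n] := ubnP (k x); elim: n x Px => // n IHn x Px /ltnSE kx.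
have [[q qx Pq]|nq] := pselect (exists2 q, q < x & P q); last first.
  by exists x => // q qx Pq; apply: nq; exists q.
apply: (IHn q Pq); apply: leq_trans kx.
have xq : ~~ (x <= q) by rewrite (lt_geF qx).
(* Entries equal to [x] and entries below [q] are disjoint, and all lie below [x]; the former occur,
   so [k q < k x]. *)
have := count_predUI (pred1 x) (<= q) s.
rewrite (@eq_count _ (predI _ _) pred0) => [|z /=]; last first.
  by case: eqVneq => //= ->; exact: negbTE.
rewrite count_pred0 addn0 => kE.
apply: (@leq_trans (count (predU (pred1 x) (<= q)) s)).
  by rewrite kE -[X in (X < _)%N]add0n ltn_add2r -has_count has_pred1.
by apply: sub_count => z /= /predU1P[->|zq] //; exact: le_trans zq (ltW qx).
Qed.

(* A minimal element among those below [x] but not below [y] is prime. *)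
Lemma prime_between x y : ~~ (x <= y) ->
  exists p, [/\ p <= x, ~~ (p <= y) &
    forall u v, p <= u `|` v -> p <= u \/ p <= v].
Proof.
move=> xy.
have [|p [px py] pmin] := @minimal_exists (fun p => p <= x /\ ~~ (p <= y)).
  by exists x.
exists p; split=> // u v puv; apply: contrapT => /not_orP[/negP pu /negP pv].
(* Here [w] meets [p] strictly below [p], so minimality applies. Distributivity then splits [p] into
   two parts below [y]. *)
have small w : ~~ (p <= w) -> w `&` p <= y.
  move=> pw; apply: contrapT => /negP wy; apply: (pmin (w `&` p)).
    by rewrite lt_neqAle leIr andbT; apply: contra pw => /eqP <-; exact: leIl.
  by split=> //; rewrite leIxr.
move/negP: py; apply; rewrite -(meet_r puv) distrM.
by rewrite leUx !small.
Qed.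

Lemma one_is_step_sum : exists r, step_sum r = 1%R.
Proof.
have [s sE] := (finite_seqP _).1 finM.
have mem_s z : z \in s by have : [set: M] z by []; rewrite sE.
(* All step maps below the identity are taken. *)
exists [seq ab <- [seq (a, b) | a <- s, b <- s] |
  `[< forall z, ~~ (z <= ab.1) -> ab.2 <= z >]].
apply: cendP => x; rewrite step_sumE /=; apply/le_anti/andP; split.
  apply/joinsP_seq => ab; rewrite mem_filter => /andP[/asboolP le_id _].
  exact: le_id.
apply: contrapT => /negP /prime_between[p [px py pprime]].
pose a := \join_(z <- s | ~~ (p <= z)) z.
have pa : ~~ (p <= a).
  apply: (big_ind (fun z => ~~ (p <= z))) => //.
    by apply: contra py => /le_trans; apply; exact: le0x.
  by move=> u v pu pv; apply/negP => /pprime[]; exact/negP.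
(* The pair [(a, p)] is in the list, since whatever is not below [a] is above [p]; it contributes at
   [x], since [p <= x] and [p] is not below [a]. *)
move/negP: py; apply; apply: (@joins_sup_seq _ _ _ _ _ _ (a, p)) => /=; last first.
  by apply: contra pa; exact: le_trans.
rewrite mem_filter allpairs_f // andbT; apply/asboolP => z /=.
by apply: contraNT => pz; exact: joins_sup_seq.
Qed.

Lemma ideal_with_steps (I : set (cend M)) :
  is_ideal I -> (forall a b, I (step a b)) -> I = [set: cend M].
Proof.
move=> idI Istep; have [r r1] := one_is_step_sum.
apply/seteqP; split=> // f _; rewrite -[f]mulr1; apply: idealMl => //.
rewrite -r1 /step_sum; apply: (big_ind I) => //; first exact: ideal0.
exact: idealD.
Qed.

Lemma cend_ideal_simple : ideal_simple (cend M).
Proof.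
move=> I idI; have [I0|/existsNP[f /not_implyP[If f0]]] :=
    pselect (forall f, I f -> f = 0%R).
  left; apply/seteqP; split=> [f /I0 //|f ->]; exact: ideal0.
right; apply: ideal_with_steps => // a b.
have [x fx] : exists x, ~~ (f x <= \bot).
  apply: contrapT => nx; apply: f0; apply: cendP => x /=; apply/eqP.
  by rewrite -lex0; apply: contrapT => /negP fx; apply: nx; exists x.
have := step_conj f x b a \bot; rewrite (negbTE fx) => <-.
by apply: (idealMl idI); exact: (Defs.idealMr idI).
Qed.

Lemma cend_congruence_simple : congruence_simple (cend M).
Proof.
move=> E cE.
have [Eeq|/existsNP[f /existsNP[g /not_implyP[Efg fg]]]] :=
    pselect (forall f g, E f g -> f = g).
  by left=> f g; split=> [/Eeq //|->]; exact: congr_refl.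
right; pose I : set (cend M) := [set h | E h 0%R].
have idI : is_ideal I.
  split.
  - exact: congr_refl.
  - by move=> h k Eh Ek; have := congrD cE Eh Ek; rewrite addr0.
  - by move=> k h Eh; have := congrM cE (congr_refl cE k) Eh; rewrite mulr0.
  - by move=> k h Eh; have := congrM cE Eh (congr_refl cE k); rewrite mul0r.
suff IT : I = [set: cend M].
  move=> h k; have Eh : I h by rewrite IT.
  have Ek : I k by rewrite IT.
  exact: (congr_trans cE Eh (congr_sym cE Ek)).
apply: ideal_with_steps => // a b.
(* With threshold [k x], sandwiching sends [k] to 0 and [h] to [step a b], so these two are
   congruent. *)
have sep (h k : cend M) x : E h k -> ~~ (h x <= k x) -> I (step a b).
  move=> Ehk hkx; have := step_conj h x b a (k x).
  have := step_conj k x b a (k x); rewrite lexx (negbTE hkx) /I /= => <- <-.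
  by do 2! [apply: (congrM cE) => //; try exact: (congr_refl cE)].
have [x fgx] : exists x, f x != g x.
  apply: contrapT => nx; apply: fg; apply: cendP => x; apply/eqP.
  by apply: contrapT => /negP fgx; apply: nx; exists x.
move: fgx; rewrite eq_le negb_and => /orP[]; first exact: sep.
by apply: sep; exact: congr_sym.
Qed.

End FiniteDistributive.
End StepMaps.

Theorem theorem3p6 (d : Order.disp_t) (M : tbLatticeType d)
    (hM : complete_lattice M) :
  [<-> simple_semiring (cend M);
       ideal_simple (cend M);
       finite_set [set: M] /\ distributive_lattice M].
Proof.
tfae.
- by case.
- move=> /(ideal_simple_one_step_sum hM)[r r1]; split.
    exact: one_step_sum_finite r1.
  exact: one_step_sum_distributive r1.
- case=> finM distrM; split; first exact: cend_ideal_simple.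
  exact: cend_congruence_simple.
Qed.
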